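(* Let $n\ge 2$ and let $\Gamma$ be a group that has a transitive action on $[n]=\{1,\dots,n\}$. Then there is a function $f\colon\Gamma\to\mathrm{Sym}(n-1)$ such that $\mathrm{def}_\infty(f)\le\frac{2}{n-1}$, but for every group homomorphism $h\colon\Gamma\to\mathrm{Sym}(n-1)$ there is $\gamma\in\Gamma$ such that $d^H(f(\gamma),h(\gamma))\ge\frac12-\frac1{n-1}$.
   Context: For $m\ge1$ and $\sigma,\tau\in\mathrm{Sym}(m)$, the normalized Hamming distance is $d^H(\sigma,\tau)=\frac1m|\{x\in[m] : \sigma(x)\ne\tau(x)\}|$. For a group $\Gamma$ and an arbitrary function $f\colon\Gamma\to\mathrm{Sym}(m)$, the uniform local defect is $\mathrm{def}_\infty(f)=\sup\{d^H(f(\gamma_1\gamma_2),f(\gamma_1)f(\gamma_2)) : \gamma_1,\gamma_2\in\Gamma\}$. *)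

(* Defs.v *)
From mathcomp Require Import all_boot all_order all_algebra all_fingroup.
From mathcomp Require Import classical_sets reals.

Set Implicit Arguments.
Unset Strict Implicit.
Unset Printing Implicit Defensive.

Import Order.TTheory GRing.Theory Num.Theory.
Local Open Scope classical_set_scope.
Local Open Scope ring_scope.

(* The product of Sym(m) as composition of functions, [s \oP t] mapping [x] to
   [s (t x)]: the group law of ['S_m] composes permutations left to right. *)
Definition perm_comp (m : nat) (s t : 'S_m) : 'S_m := (t * s)%g.

Notation "s \oP t" := (perm_comp s t) (at level 40, left associativity).

Lemma perm_compE (m : nat) (s t : 'S_m) (x : 'I_m) : (s \oP t) x = s (t x).
Proof. by rewrite permM. Qed.

Definition hamming (R : realType) (m : nat) (s t : 'S_m) : R :=
  #|[set x : 'I_m | s x != t x]%SET|%:R / m%:R.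

(* For [0 < m] the supremum is over a nonempty set of reals bounded by [1], so
   the total function [sup] is the genuine least upper bound. *)
Definition def_infty (R : realType) (G : groupType) (m : nat)
    (f : G -> 'S_m) : R :=
  sup [set hamming R (f (g.1 * g.2)%g) (f g.1 \oP f g.2) | g in [set: G * G]].

(* The actions of [mathcomp.fingroup.action] are restricted to finite groups. *)
Definition is_left_action (G : groupType) (X : Type) (act : G -> X -> X) : Prop :=
  (forall x, act 1%g x = x) /\
  (forall g1 g2 x, act (g1 * g2)%g x = act g1 (act g2 x)).

Definition is_transitive (G : groupType) (X : Type) (act : G -> X -> X) : Prop :=
  forall x y, exists g, act g x = y.

Definition is_hom (G : groupType) (m : nat) (h : G -> 'S_m) : Prop :=
  {morph h : g1 g2 / (g1 * g2)%g >-> g1 \oP g2}.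

(* Main.v *)
(** Embed [n-1] in [n] by a map [J] and let [f g] be the permutation [g] of [n]
    with the point outside the image of [J] cut out of its cycle. Then [f g] is
    [g] except at one point at most, whence the bound on the defect.

    If a homomorphism [h] were too close to [f], then [g] and [h g] would agree
    on more than half of [n-1] for all [g]. Averaging over the (finite) image
    [H] of the group in Sym(n) * Sym(n-1) yields a point [y0] such that the pair
    [(x, y) = (J y0, y0)] satisfies [p.1 x = J (p.2 y)] for more than half of
    the [p] in [H]. This property is invariant under [H], so by transitivity
    every [x] has a partner [y] satisfying it; and no [y] is the partner of two
    points, since two majorities would share some [p]. So [n] embeds in
    [n-1]. *)
Require Import Defs.
From mathcomp Require Import all_boot all_order all_algebra all_fingroup.
From mathcomp Require Import classical_sets reals.
From mathcomp Require Import boolp zify lra.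

Import Order.TTheory GRing.Theory Num.Theory.
Local Open Scope ring_scope.

Section Majority.
Local Open Scope nat_scope.
Variables (X Y : finType) (J : Y -> X) (H : {group ({perm X} * {perm Y})%type}).

Let agree x y := [set p in H | p.1 x == J (p.2 y)].

(** Left translation by [q^-1] injects the first set into the second: under the left-to-right
    product, [q^-1 * p] undoes [q] before applying [p]. *)
Lemma card_agree_invariant q x y :
  q \in H -> #|agree x y| <= #|agree (q.1 x) (q.2 y)|.
Proof.
move=> qH; rewrite -(card_imset _ (mulgI q^-1%g)); apply: subset_leq_card.
apply/fintype.subsetP => _ /imsetP[p + ->]; rewrite !inE => /andP[pH pxy].
by rewrite groupM ?groupV //= !permM !permK.
Qed.

Lemma card_le_of_majority_agreement :
  (forall x x', exists2 p, p \in H & p.1 x = x') ->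
  (forall p, p \in H -> #|Y| < 2 * #|[set y | p.1 (J y) == J (p.2 y)]|) ->
  #|X| <= #|Y|.
Proof.
move=> trH majH.
have [y0 maj0] : exists y0, #|H| < 2 * #|agree (J y0) y0|.
  apply/existsP; apply: contraT; rewrite negb_exists => /forallP small.
  (* Double counting of the pairs [(p, y)] that agree: the sum over [y] is bounded by [small], while
     the strict majority for each [p] contributes at least [#|Y|.+1]. *)
  have : \sum_(p in H) 2 * #|[set y | p.1 (J y) == J (p.2 y)]| <= #|Y| * #|H|.
    have -> : \sum_(p in H) 2 * #|[set y | p.1 (J y) == J (p.2 y)]|
            = \sum_y 2 * #|agree (J y) y|.
      rewrite -!big_distrr /=; congr (2 * _).
      under eq_bigr do rewrite -sum1dep_card big_mkcond.
      rewrite exchange_big; apply: eq_bigr => y _.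
      by rewrite -sum1dep_card big_mkcondr.
    by rewrite -sum_nat_const; apply: leq_sum => y _; rewrite leqNgt small.
  suff : #|Y|.+1 * #|H| <= \sum_(p in H) 2 * #|[set y | p.1 (J y) == J (p.2 y)]|.
    have := cardG_gt0 H; lia.
  by rewrite mulnC -sum_nat_const; apply: leq_sum => p /majH.
have partner x : exists y, #|H| < 2 * #|agree x y|.
  have [q qH <-] := trH (J y0) x.
  exists (q.2 y0); have := card_agree_invariant q (J y0) y0 qH; lia.
pose F x := xchoose (partner x).
apply: (@leq_card _ _ F) => x x' FE.
have maj := xchooseP (partner x); have maj' := xchooseP (partner x').
rewrite -/(F x) in maj; rewrite -/(F x') -FE in maj'.
(* Disjoint majorities would overfill [H]. A common [p] sends [x] and [x'] to the same point
   [J (p.2 (F x))]. *)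
have [dis|] := boolP [disjoint agree x (F x) & agree x' (F x)].
  have : #|agree x (F x) :|: agree x' (F x)| <= #|H|.
    by apply: subset_leq_card; apply/fintype.subsetP => p; rewrite !inE -andb_orr => /andP[].
  move: dis; rewrite -leq_card_setU => /eqP ->; lia.
case/pred0Pn => p /=; rewrite !inE => /andP[/andP[_ /eqP e] /andP[_ /eqP e']].
by apply: (@perm_inj _ p.1); rewrite e e'.
Qed.

End Majority.

Section CutMax.
Variable m : nat.
Local Notation J := (lift (@ord_max m)).

Definition skip_max (s : 'S_m.+1) (x : 'I_m.+1) : 'I_m.+1 :=
  if s x == ord_max then s ord_max else s x.

(** The default [y] is never reached: if both [J y] and [ord_max] were sent to [ord_max],
    injectivity of [s] would identify them. *)
Definition cut_max_fun (s : 'S_m.+1) (y : 'I_m) : 'I_m :=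
  odflt y (unlift ord_max (skip_max s (J y))).

Lemma lift_cut_max_fun s y : J (cut_max_fun s y) = skip_max s (J y).
Proof.
rewrite /cut_max_fun; case: unliftP => [z -> //|].
rewrite /skip_max; case: eqP => [e e'|//].
by have /eqP := perm_inj (etrans e (esym e')); rewrite eq_sym (negPf (neq_lift _ _)).
Qed.

Lemma cut_max_fun_inj s : injective (cut_max_fun s).
Proof.
move=> y z /(congr1 J); rewrite !lift_cut_max_fun /skip_max.
have neqJ w : (ord_max == J w) = false by apply/negbTE/neq_lift.
case: eqP => [ey|_]; case: eqP => [ez|_].
- by move=> _; apply: (@lift_inj _ ord_max); apply: (@perm_inj _ s); rewrite ey ez.
- by move=> /perm_inj /eqP; rewrite neqJ.
- by move=> /perm_inj /eqP; rewrite eq_sym neqJ.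
- by move=> /perm_inj /lift_inj.
Qed.

Definition cut_max (s : 'S_m.+1) : 'S_m := perm (@cut_max_fun_inj s).

Lemma lift_cut_max (s : 'S_m.+1) y : s (J y) != ord_max -> J (cut_max s y) = s (J y).
Proof. by rewrite permE lift_cut_max_fun /skip_max => /negPf ->. Qed.

Lemma card_lift_to_max (s : 'S_m.+1) :
  (#|[set y : 'I_m | s (J y) == ord_max]%SET| <= 1)%N.
Proof.
apply/card_le1_eqP => y z; rewrite !inE => /eqP ey /eqP ez.
by apply: (@lift_inj _ ord_max); apply: (@perm_inj _ s); rewrite ey ez.
Qed.

(** The two sides can differ only where [t] or [s \oP t] sends [J y] to [ord_max], which happens for
    at most one [y] each; elsewhere both lift to [s (t (J y))]. *)
Lemma card_cut_maxM (s t : 'S_m.+1) :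
  (#|[set y : 'I_m | cut_max (s \oP t) y != (cut_max s \oP cut_max t) y]%SET| <= 2)%N.
Proof.
have := card_lift_to_max t; have := card_lift_to_max (s \oP t).
set A := finset _; set B := finset _ => A1 B1; set C := finset _.
have : (#|C| <= #|A :|: B|)%N.
  apply: subset_leq_card; apply/fintype.subsetP => y; rewrite !inE.
  apply: contraNT; rewrite negb_or => /andP[ny my].
  apply/eqP/(@lift_inj _ ord_max).
  rewrite lift_cut_max // !perm_compE lift_cut_max ?lift_cut_max //.
  by rewrite -perm_compE.
have := (leq_card_setU A B).1; lia.
Qed.

(** The final [1] accounts for the possible [y] with [s (J y) = ord_max]; at any other [y],
    [cut_max s y] lifts to [s (J y)]. *)
Lemma card_agree_cut_max (s : 'S_m.+1) (t : 'S_m) :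
  (m <= #|[set y : 'I_m | s (J y) == J (t y)]%SET|
        + #|[set y : 'I_m | cut_max s y != t y]%SET| + 1)%N.
Proof.
have := card_lift_to_max s.
set A := finset _; set B := finset _; set C := finset _ => A1.
have : (#|[set: 'I_m]| <= #|B :|: C :|: A|)%N.
  apply: subset_leq_card; apply/fintype.subsetP => y _; rewrite !inE.
  apply: contraT; rewrite !negb_or negbK -andbA => /and3P[sy /eqP e my].
  by move: sy; rewrite -e lift_cut_max ?eqxx.
rewrite cardsT card_ord.
have := (leq_card_setU (B :|: C) A).1; have := (leq_card_setU B C).1; lia.
Qed.

End CutMax.

Section ActionPerm.
Variables (G : groupType) (X : finType) (act : G -> X -> X).
Hypothesis hact : is_left_action act.

Lemma left_action_inj g : injective (act g).
Proof.
case: hact => act1 actM; apply: (can_inj (g := act g^-1%g)) => x.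
by rewrite -actM mulVg act1.
Qed.

Definition action_perm g : {perm X} := perm (@left_action_inj g).

Lemma action_permE g x : action_perm g x = act g x.
Proof. exact: permE. Qed.

Lemma action_permM g1 g2 :
  action_perm (g1 * g2)%g = (action_perm g2 * action_perm g1)%g.
Proof. by apply/permP => x; rewrite permM !action_permE; case: hact => _ ->. Qed.

End ActionPerm.

(* [\oP] is the multiplication of the opposite of ['S_m], hence antimorphisms. *)
Lemma range_group_set (G : groupType) (gT : finGroupType) (phi : G -> gT) :
  {morph phi : g1 g2 / (g1 * g2)%g >-> (g2 * g1)%g} ->
  group_set [set p | `[< exists g, phi g = p >]]%SET.
Proof.
move=> phiM; apply/group_setP; split => [|p q]; rewrite !inE.
  by exists 1%g; apply: (mulgI (phi 1%g)); rewrite -phiM !mulg1.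
by move=> [g <-] [k <-]; exists (k * g)%g; rewrite phiM.
Qed.

Theorem theorem1p1 (R : realType) (n : nat) (hn : (2 <= n)%N)
    (G : groupType) (act : G -> 'I_n -> 'I_n)
    (hact : is_left_action act) (htrans : is_transitive act) :
  exists f : G -> 'S_n.-1,
    def_infty R f <= 2 / n.-1%:R /\
    forall h : G -> 'S_n.-1, is_hom h ->
      exists g : G, hamming R (f g) (h g) >= 1 / 2 - 1 / n.-1%:R.
Proof.
case: n hn act hact htrans => [//|m] hm act hact htrans /=.
have m_gt0 : 0 < m%:R :> R by rewrite ltr0n.
pose a := @action_perm _ _ _ hact.
exists (fun g => cut_max m (a g)); split.
  apply: ge_sup => [|_ [[g1 g2] _ <-] /=].
    by apply: image_nonempty; exists (1%g, 1%g).
  rewrite /hamming ler_pM2r ?invr_gt0 // ler_nat /a action_permM.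
  exact: card_cut_maxM.
move=> h hM; apply: contrapT => /forallNP far.
have phiM : {morph (fun g => (a g, h g)) : g1 g2 / (g1 * g2)%g >-> (g2 * g1)%g}.
  by move=> g1 g2; rewrite /a action_permM hM.
pose H := Group (range_group_set _ _ _ phiM).
suff : (#|'I_m.+1| <= #|'I_m|)%N by rewrite !card_ord ltnn.
apply: (@card_le_of_majority_agreement _ _ (lift ord_max) H) => [x x'|p].
  have [g gx] := htrans x x'; exists (a g, h g); last by rewrite /= action_permE.
  by rewrite inE; apply/asboolP; exists g.
rewrite inE => /asboolP[g <-] /=; rewrite card_ord.
have /negP := far g; rewrite -ltNge /hamming.
have := card_agree_cut_max m (a g) (h g).
set A := #|_|; set D := #|_| => AD close.
(* This is [D / m < 1 / 2 - 1 / m] multiplied by [2 * m]. Together with [m <= A + D + 1] it gives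
   [m < 2 * A], the required majority. *)
have : (2 * D + 2 < m)%N.
  rewrite -(ltr_nat R) natrD natrM.
  have : D%:R + 1 < m%:R / 2 :> R.
    by move: close; rewrite ltrBrDr -mulrDl ltr_pdivrMr // mulrC mul1r mulrC.
  lra.
lia.
Qed.
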